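(* For every permutation $\pi$, $b(\pi)=d_+(\pi)$; that is, the number of occurrences of $\mathrm{Box}(12)$ in $\pi$ equals the up-degree of $\pi$ in the strong Bruhat order.
   Context: $\mathfrak S_n$ is the set of permutations $\pi=\pi_1\cdots\pi_n$ of $\{1,\dots,n\}$. An occurrence of the boxed pattern $\mathrm{Box}(12)$ in $\pi$ is a pair of positions $i<j$ with $\pi_i<\pi_j$ such that no $k$ with $i<k<j$ satisfies $\pi_i<\pi_k<\pi_j$; $b(\pi)$ is the number of such occurrences. The inversion number is $\ell(\pi)=|\{(i,j):1\le i<j\le n,\ \pi_i>\pi_j\}|$. For $1\le i<j\le n$, $\pi(i\leftrightarrow j)$ is obtained from $\pi$ by interchanging the entries in positions $i$ and $j$. The strong Bruhat order on $\mathfrak S_n$ is the transitive closure of the covering relations $\pi\lessdot\pi(i\leftrightarrow j)$, which holds if and only if $\ell(\pi(i\leftrightarrow j))=\ell(\pi)+1$. The up-degree of $\pi$ is $d_+(\pi)=|\{\sigma\in\mathfrak S_n:\pi\lessdot\sigma\}|$. *)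

(* Defs.v *)
From mathcomp Require Import all_boot all_fingroup.

Set Implicit Arguments.
Unset Strict Implicit.
Unset Printing Implicit Defensive.

(* Positions and values are 0-based, i.e., they range over 'I_n. *)

Definition box12_occ n (pi : 'S_n) (i j : 'I_n) : bool :=
  [&& i < j, pi i < pi j
    & ~~ [exists k : 'I_n, (i < k < j) && (pi i < pi k < pi j)]].

Definition nb_box12 n (pi : 'S_n) : nat :=
  #|[set p : 'I_n * 'I_n | box12_occ pi p.1 p.2]|.

Definition inv_number n (pi : 'S_n) : nat :=
  #|[set p : 'I_n * 'I_n | (p.1 < p.2) && (pi p.2 < pi p.1)]|.

(* Products of permutations compose from left to right, so that
   swap_entries pi i j maps k to pi (tperm i j k): this exchanges the entries
   at the positions i and j, not the values i and j. *)
Definition swap_entries n (pi : 'S_n) (i j : 'I_n) : 'S_n :=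
  (tperm i j * pi)%g.

Definition bruhat_cover n : rel 'S_n := fun pi sigma =>
  [exists i : 'I_n, exists j : 'I_n,
    [&& i < j, sigma == swap_entries pi i j
      & inv_number sigma == (inv_number pi).+1]].

Definition up_degree n (pi : 'S_n) : nat :=
  #|[set sigma : 'S_n | bruhat_cover pi sigma]|.

(* Main.v *)
Require Import Defs.
From mathcomp Require Import all_boot all_fingroup.
From mathcomp Require Import zify.

(** Interchanging the entries [a < b] of [pi] at positions [i < j] turns the
pair [(i, j)] into an inversion.  Pairs that avoid both positions are
unaffected, and for a third position [k] the number of inversions that [k]
forms with [i] and [j] changes only if [k] lies between [i] and [j] and its
entry lies between [a] and [b], in which case it grows from 0 to 2.  Hence the
inversion number grows by [1 + 2 m], where [m] counts the entries inside the
box spanned by the two positions ([inv_number_swap_entries]).  If instead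
[a > b], undoing the interchange shows that the inversion number drops.  So the
interchange is a cover exactly when the entries rise and the box is empty,
which is an occurrence of the boxed pattern ([inv_number_swap_entries_eqS]).
Distinct pairs of positions give distinct transpositions, so occurrences and
upper covers are in bijection. *)

Set Implicit Arguments.
Unset Strict Implicit.
Unset Printing Implicit Defensive.

Definition in_box n (pi : 'S_n) (i j k : 'I_n) : bool :=
  (i < k < j) && (pi i < pi k < pi j).

Lemma inv_number_sum n (pi : 'S_n) :
  inv_number pi = \sum_(x < n) \sum_(y < n) (x < y) && (pi y < pi x).
Proof.
rewrite /inv_number -sum1dep_card big_mkcond pair_bigA /=.
by apply: eq_bigr => p _; case: (_ && _).
Qed.

Lemma sum_split2 (T : finType) (i j : T) (F : T -> nat) : i != j ->
  \sum_x F x = F i + F j + \sum_(x | (x != i) && (x != j)) F x.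
Proof.
by move=> ij; rewrite (bigD1 i) //= (bigD1 j) ?addnA // eq_sym.
Qed.

(** Isolates what a double sum owes to two indices, so that two such sums that
agree away from these indices can be compared one third index at a time. *)
Lemma sum2_split2 (T : finType) (i j : T) (F : T -> T -> nat) : i != j ->
  \sum_x \sum_y F x y =
    (F i i + F i j + F j i + F j j)
    + \sum_(k | (k != i) && (k != j)) (F i k + F j k + F k i + F k j)
    + \sum_(x | (x != i) && (x != j)) \sum_(y | (y != i) && (y != j)) F x y.
Proof.
move=> ij; rewrite (sum_split2 _ ij) !(sum_split2 (F _) ij).
under [X in _ + X]eq_bigr => x _ do rewrite (sum_split2 (F x) ij).
rewrite !big_split /=; lia.
Qed.

Lemma swap_entriesL n (pi : 'S_n) i j : swap_entries pi i j i = pi j.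
Proof. by rewrite permM tpermL. Qed.

Lemma swap_entriesR n (pi : 'S_n) i j : swap_entries pi i j j = pi i.
Proof. by rewrite permM tpermR. Qed.

Lemma swap_entriesD n (pi : 'S_n) (i j k : 'I_n) :
  (k != i) && (k != j) -> swap_entries pi i j k = pi k.
Proof. by case/andP=> ki kj; rewrite permM tpermD // eq_sym. Qed.

Lemma swap_entriesK n (pi : 'S_n) i j :
  swap_entries (swap_entries pi i j) i j = pi.
Proof. by rewrite /swap_entries mulgA tperm2 mul1g. Qed.

(** A third position [k] with entry [c] compares the same way with [i] and [j]
unless it lies between them, and likewise for [c] against the entries [a < b];
an entry inside the box is below its left corner and above its right one once
the corners are interchanged, and formed no inversion before. *)
Lemma inversions_third_position (i j k a b c : nat) :
  i < j -> a < b -> k != i -> k != j -> c != a -> c != b ->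
  ((i < k) && (c < b) : nat) + ((j < k) && (c < a))
    + ((k < i) && (b < c)) + ((k < j) && (a < c))
  = ((i < k) && (c < a) : nat) + ((j < k) && (c < b))
    + ((k < i) && (a < c)) + ((k < j) && (b < c))
    + 2 * ((i < k < j) && (a < c < b)).
Proof. lia. Qed.

Lemma inv_number_swap_entries n (pi : 'S_n) (i j : 'I_n) :
    i < j -> pi i < pi j ->
  inv_number (swap_entries pi i j)
    = (inv_number pi + 2 * #|[set k | in_box pi i j k]|).+1.
Proof.
move=> ltij ltpi; have ij : i != j by rewrite -val_eqE /= ltn_eqF.
rewrite !inv_number_sum.
rewrite !(sum2_split2 (fun x y : 'I_n => nat_of_bool (_ && _)) ij).
rewrite swap_entriesL swap_entriesR.
set R1 := (X in _ + _ + X = _); set R2 := (X in _ = (_ + _ + X + _).+1).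
have -> : R1 = R2.
  apply: eq_bigr => x Px; apply: eq_bigr => y Py.
  by rewrite !swap_entriesD.
set M1 := (X in _ + X + _ = _); set M2 := (X in _ = (_ + X + _ + _).+1).
have -> : M1 = M2 + 2 * #|[set k | in_box pi i j k]|.
  rewrite -sum1dep_card big_mkcond /= (sum_split2 _ ij) /in_box.
  rewrite !ltnn ?andbF /= !add0n big_distrr -big_split /=.
  apply: eq_bigr => k Pk; rewrite !swap_entriesD //.
  case/andP: Pk => ki kj.
  have pki : pi k != pi i by rewrite (inj_eq perm_inj).
  have pkj : pi k != pi j by rewrite (inj_eq perm_inj).
  exact: inversions_third_position.
rewrite !ltnn ltij ltpi /=; lia.
Qed.

(** A swap of falling entries is undone by a swap of rising ones, so it cannot
raise the inversion number. *)
Lemma inv_number_swap_entries_eqS n (pi : 'S_n) (i j : 'I_n) : i < j ->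
  (inv_number (swap_entries pi i j) == (inv_number pi).+1)
    = box12_occ pi i j.
Proof.
move=> ltij; rewrite /box12_occ ltij /=.
case: ltngtP => [ltpi|gtpi|/val_inj/perm_inj eqij] /=.
- rewrite (inv_number_swap_entries ltij ltpi) eqSS -[X in _ == X]addn0 eqn_add2l.
  rewrite muln_eq0 /= cards_eq0; apply/eqP/existsPn => [box0 k|noK].
    by have := in_set0 k; rewrite -box0 inE => /negbT.
  by apply/setP=> k; rewrite !inE; apply: negbTE (noK k).
- have := @inv_number_swap_entries n (swap_entries pi i j) i j ltij.
  rewrite swap_entriesL swap_entriesR swap_entriesK => /(_ gtpi) ->; lia.
- by rewrite eqij ltnn in ltij.
Qed.

Lemma tperm_ltn_inj n (i j i' j' : 'I_n) :
  i < j -> i' < j' -> tperm i j = tperm i' j' -> (i, j) = (i', j').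
Proof.
move=> ltij ltij' eqt; have := tpermL i j; rewrite eqt.
case: tpermP => [->|ii'|_ _ eqij]; first by move->.
  by move=> i'j; move: ltij ltij'; rewrite ii' -i'j ltnNge => /negP ? /ltnW.
by rewrite eqij ltnn in ltij.
Qed.

Theorem proposition8p1 (n : nat) (pi : 'S_n) : nb_box12 pi = up_degree pi.
Proof.
rewrite /nb_box12 /up_degree.
rewrite -(card_in_imset (f := fun p => swap_entries pi p.1 p.2)); last first.
  move=> [i j] [i' j']; rewrite !inE /= => /and3P[ltij _ _] /and3P[ltij' _ _].
  by move/mulIg; apply: tperm_ltn_inj.
apply: eq_card => sigma; rewrite inE; apply/imsetP/existsP.
  case=> -[i j]; rewrite inE /= => occ ->.
  have ltij : i < j by case/and3P: occ.
  exists i; apply/existsP; exists j.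
  by rewrite ltij eqxx inv_number_swap_entries_eqS.
case=> i /existsP[j /and3P[ltij /eqP-> cov]].
by exists (i, j); rewrite // inE /= -inv_number_swap_entries_eqS.
Qed.
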